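(* Let $G$ be a finitely generated abelian group, written as \[ G=\Big(\bigoplus_{i=1}^{m_1}\mathbb{Z}/(2n_i+1)\mathbb{Z}\Big)\oplus\Big(\bigoplus_{i=1}^{m_2}\mathbb{Z}/2\mathbb{Z}\Big)\oplus\Big(\bigoplus_{i=1}^{m_3}\mathbb{Z}/(4q_i)\mathbb{Z}\Big)\oplus\Big(\bigoplus_{i=1}^{r}\mathbb{Z}\Big), \] with $n_i,q_i$ positive integers and $m_1,m_2,m_3,r\ge 0$. Then the maximal size $m$ of an avoidable subset of $G$ containing an even element is: (a) $1+2^{m_2-1}$, if $m_1=m_3=r=0$; (b) $2$, if $m_2=m_3=r=0$; (c) $2+2^{m_2-1}$, if $m_3=r=0$ and $m_2\neq 0$; (d) $2+2^{m_2}$ otherwise.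
   Context: For a set $S$ with a binary operation, a subset $U\subseteq S$ is avoidable if there is a partition $\{A,B\}$ of $S$ such that no element of $U$ is the product (here: sum) of two distinct elements of $A$ or of two distinct elements of $B$. In an abelian group written additively, an element $b$ is even if there exists $x$ with $2x=b$, and odd otherwise.
   Formalization: The trivial group (m1=m2=m3=r=0), where (a) gives 3/2 and (b) gives 2 for a one-element group, is excluded: (a) assumes m2≠0 and (b) assumes m1≠0. Case (c) assumes m1≠0, since otherwise it contradicts (a), e.g. for Z/2. *)

(* Defs.v *)
From HB Require Import structures.
From mathcomp Require Import all_boot all_order all_algebra.
From mathcomp Require Import boolp classical_sets functions cardinality.

Set Implicit Arguments.
Unset Strict Implicit.
Unset Printing Implicit Defensive.

Import GRing.Theory.
Local Open Scope classical_set_scope.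
Local Open Scope card_scope.
Local Open Scope ring_scope.

(* The library has the pointwise group structure on {ffun I -> V} only for a
   constant codomain; a direct sum of different cyclic groups needs the
   dependent version. *)
Section DffunZmod.
Variables (I : finType) (V : I -> zmodType).
Implicit Types f g h : {dffun forall i, V i}.

Definition dffun_zero : {dffun forall i, V i} := [ffun i => 0].
Definition dffun_opp f : {dffun forall i, V i} := [ffun i => - f i].
Definition dffun_add f g : {dffun forall i, V i} := [ffun i => f i + g i].

Fact dffun_addA : associative dffun_add.
Proof. by move=> f g h; apply/ffunP => i; rewrite !ffunE addrA. Qed.

Fact dffun_addC : commutative dffun_add.
Proof. by move=> f g; apply/ffunP => i; rewrite !ffunE addrC. Qed.

Fact dffun_add0 : left_id dffun_zero dffun_add.
Proof. by move=> f; apply/ffunP => i; rewrite !ffunE add0r. Qed.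

Fact dffun_addN : left_inverse dffun_zero dffun_opp dffun_add.
Proof. by move=> f; apply/ffunP => i; rewrite !ffunE addNr. Qed.

HB.instance Definition _ := GRing.isZmodule.Build {dffun forall i, V i}
  dffun_addA dffun_addC dffun_add0 dffun_addN.

End DffunZmod.

(* 'Z_k is the ring of integers mod k only for 1 < k, so the factors are the
   intended ones only when all n i and q i are positive. *)
Definition fgab (m1 m2 m3 r : nat) (n : 'I_m1 -> nat) (q : 'I_m3 -> nat)
    : zmodType :=
  ({dffun forall i : 'I_m1, 'Z_(2 * n i + 1)} * {ffun 'I_m2 -> 'Z_2} *
   {dffun forall i : 'I_m3, 'Z_(4 * q i)} * {ffun 'I_r -> int})%type.

(* The two parts are nonempty, as usual for a partition. As soon as S has two
   elements this is immaterial: from (set0, setT) one can move any one element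
   to the first part. *)
Definition avoidable (S : Type) (op : S -> S -> S) (U : set S) : Prop :=
  exists A B : set S,
    [/\ A !=set0, B !=set0, A `|` B = setT & A `&` B = set0] /\
    (forall u, U u ->
       ~ (exists x y, [/\ A x, A y, x <> y & op x y = u]) /\
       ~ (exists x y, [/\ B x, B y, x <> y & op x y = u])).

Definition even_elt (G : zmodType) (b : G) : Prop := exists x : G, x *+ 2 = b.

(* A member of the family F may be infinite: the upper bound compares
   cardinals, so it also says that every member of F is finite. *)
Definition is_max_size (T : Type) (F : set (set T)) (m : nat) : Prop :=
  (exists2 U, F U & U #= `I_m) /\ (forall U, F U -> U #<= `I_m).

Definition avoidable_with_even (G : zmodType) : set (set G) :=
  [set U | avoidable +%R U /\ exists2 b, U b & even_elt b].
Arguments avoidable_with_even : clear implicits.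

(* Main.v *)
From HB Require Import structures.
Require Import Defs.
From mathcomp Require Import all_boot all_order all_algebra zify.
From mathcomp Require Import boolp classical_sets functions cardinality.

(* U is avoidable iff the graph joining x <> y when x + y is in U is bipartite.

   Upper bounds: three distinct elements of U with even sum give a triangle, and
   an even 2d in U together with odd u, v in U such that 2(u - v) <> 0 gives a
   5-cycle. So if U contains an even element, it contains at most two of them;
   its odd elements differ by involutions and lie in distinct cosets of 2G, hence
   are separated by their coordinate tau in V = (Z/2)^m2. When m3 = r = 0, tau
   identifies G/2G with V, and the triangles make the set of values of tau on the
   odd elements of U sum-free, so it fills at most half of V.

   Lower bounds: take {0, 2e} together with e + T, where e lies in one cyclic
   summand C and T in V. The reflections x -> u - x (u in this set) act as
   negation on the summands other than C and V, so off the fixed points of that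
   negation an antisymmetric choice of signs is a proper colouring; on the fixed
   points one uses a colouring of C, twisted by a character of V. For C = Z or
   Z/4q, with e = 1, all T = V is possible; for C odd, with e = 1/2, T is the
   complement of the kernel of a character. *)

Set Implicit Arguments.
Unset Strict Implicit.
Unset Printing Implicit Defensive.

Local Open Scope ring_scope.
Import GRing.Theory.

(** * Avoidability as 2-colourability of the sum graph *)

Definition two_coloring (S : Type) (op : S -> S -> S) (U : set S)
    (f : S -> bool) : Prop :=
  forall x y, x <> y -> U (op x y) -> f x != f y.

Lemma avoidable_two_coloring (S : Type) (op : S -> S -> S) (U : set S) :
  avoidable op U -> exists f, two_coloring op U f.
Proof.
case=> A [B [[_ _ AB _] hU]]; exists (fun x => `[< A x >]) => x y xy Uxy.
have [nA nB] := hU _ Uxy; have cov z : A z \/ B z.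
  by have : (A `|` B)%classic z by rewrite AB.
apply/negP => /eqP; case: (asboolP (A x)) => Ax; case: asboolP => // Ay _.
  by apply: nA; exists x, y.
by apply: nB; exists x, y; split => //; [case: (cov x) | case: (cov y)].
Qed.

(** An edge is required so that both colour classes are nonempty. *)
Lemma two_coloring_avoidable (S : Type) (op : S -> S -> S) (U : set S) f :
  (exists x y, x <> y /\ U (op x y)) -> two_coloring op U f -> avoidable op U.
Proof.
move=> [a [b [ab Uab]]] fU.
exists [set x | f x]%classic, [set x | ~~ f x]%classic; split; last first.
  move=> u Uu; split=> -[x [y [/= fx fy xy xyu]]]; rewrite -xyu in Uu;
  by move: (fU _ _ xy Uu) fx fy; case: (f x); case: (f y).
have := fU _ _ ab Uab; case fa : (f a); case fb : (f b) => // _.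
  split; [by exists a | by exists b; rewrite /= fb| |].
  - by apply/seteqP; split => x //= _; case: (f x); [left|right].
  - by apply/seteqP; split => x //= -[->].
split; [by exists b | by exists a; rewrite /= fa| |].
- by apply/seteqP; split => x //= _; case: (f x); [left|right].
- by apply/seteqP; split => x //= -[->].
Qed.

(** * Cardinalities through finite index sets *)

Lemma card_le_finset (T : Type) (F : finType) (A : set T) (D : {set F})
    (g : T -> F) :
  (forall x, A x -> g x \in D) -> (forall x y, A x -> A y -> g x = g y -> x = y) ->
  (A #<= `I_#|D|)%card.
Proof.
move=> gD ginj; pose i x := index (g x) (enum D).
have iinj : {in A &, injective i}.
  move=> x y /set_mem Ax /set_mem Ay ixy; apply: ginj => //.
  rewrite -[LHS](nth_index (g x) (s := enum D)) ?mem_enum ?gD//.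
  by rewrite -/(i x) ixy /i nth_index ?mem_enum ?gD.
rewrite -(card_le_eql (inj_card_eq iinj)); apply: subset_card_le.
by move=> _ [x Ax <-] /=; rewrite /i cardE index_mem mem_enum gD.
Qed.

Lemma card_eq_finset (T : Type) (F : finType) (D : {set F}) (g : F -> T) :
  {in D &, injective g} ->
  ([set u | exists2 x, x \in D & g x = u]%classic #= `I_#|D|)%card.
Proof.
(* A member of [D] serves as the default of [nth], so empty [D] is treated apart. *)
move=> ginj; have [D0|[x0 Dx0]] := set_0Vmem D.
  rewrite D0 cards0 II0 card_eq0; apply/eqP/seteqP; split=> // u [x].
  by rewrite inE.
pose h k := g (nth x0 (enum D) k).
have nD k : (k < #|D|)%N -> nth x0 (enum D) k \in D.
  by move=> kD; rewrite -mem_enum mem_nth -?cardE.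
have hinj : {in `I_#|D| &, injective h}.
  move=> k l /set_mem /= kD /set_mem /= lD hkl; apply/eqP.
  rewrite -(nth_uniq x0 _ _ (enum_uniq D)) -?cardE //.
  by apply/eqP/ginj; rewrite ?nD.
rewrite -(card_eqr (inj_card_eq hinj)).
suff -> : [set u | exists2 x, x \in D & g x = u]%classic = (h @` `I_#|D|)%classic.
  exact: card_eqxx.
apply/seteqP; split=> [u [x xD <-]|u [k /= kD <-]]; last first.
  by exists (nth x0 (enum D) k); rewrite ?nD.
by exists (index x (enum D)); rewrite /= /h ?cardE ?index_mem ?nth_index ?mem_enum.
Qed.

(** * Colouring the extremal sets *)

(** The canonical choice from [{a, -a}] depends only on the unordered pair, so exactly one of [a],
    [-a] is the chosen one unless they coincide. *)
Lemma exists_antisymmetric (A : zmodType) :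
  exists g : A -> bool, forall a, a + a <> 0 -> g (- a) = ~~ g a.
Proof.
exists (fun a => choose (pred2 a (- a)) a == a) => a a2.
have aN : a != - a by rewrite -addr_eq0; apply/eqP.
have eP : pred2 (- a) (- - a) =1 pred2 a (- a) by move=> x; rewrite /= opprK orbC.
rewrite (eq_choose eP) (choose_id (y0 := a)) /= ?eqxx ?orbT //.
have /pred2P[->|->] : pred2 a (- a) (choose (pred2 a (- a)) a).
  by apply: chooseP; rewrite /= eqxx.
  by rewrite eqxx; apply: negbTE.
by rewrite eqxx eq_sym aN.
Qed.

(** In the extremal sets the left summand labels [0] and [2e], the right one the points [e + j v];
    in the upper bound they label the even and the odd elements of [U]. *)
Definition dsum (F1 F2 : finType) (E : {set F1}) (T : {set F2}) : {set F1 + F2} :=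
  inl @: E :|: inr @: T.

Lemma card_dsum (F1 F2 : finType) (E : {set F1}) (T : {set F2}) :
  #|dsum E T| = (#|E| + #|T|)%N.
Proof.
rewrite cardsU (_ : _ :&: _ = finset.set0); last first.
  apply/setP=> x; rewrite !inE; apply/negP => /andP[/imsetP[y _ ->]].
  by case/imsetP.
rewrite cards0 subn0 !card_imset //; [exact: inr_inj|exact: inl_inj].
Qed.

Lemma mem_dsum (F1 F2 : finType) (E : {set F1}) (T : {set F2}) x :
  (x \in dsum E T) = match x with inl a => a \in E | inr b => b \in T end.
Proof.
rewrite !inE; case: x => [a|b].
  rewrite mem_imset; last exact: inl_inj.
  by rewrite orbC; case: imsetP => // -[].
rewrite mem_imset; last exact: inr_inj.
by case: imsetP => // -[].
Qed.

Definition twin_point (V G : zmodType) (e : G) (j : V -> G) (x : bool + V) : G :=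
  match x with inl b => if b then e + e else 0 | inr v => e + j v end.

Definition twin_set (V : finZmodType) (G : zmodType) (e : G) (j : V -> G)
    (E : {set bool}) (T : {set V}) : set G :=
  [set u | exists2 x, x \in dsum E T & twin_point e j x = u]%classic.

(** The ends of an edge have opposite values of [p], the part outside [C] and [V]. Where
    [2 p x <> 0] the antisymmetric [g] separates them. Elsewhere the colour is [f (c x)] twisted by
    [chi (tau x)]: for the sums [0] and [2e] the twists cancel, for [e + j v] they differ by
    [chi v], which the last hypothesis takes into account. *)
Lemma twin_set_coloring (G C : zmodType) (V : finZmodType)
    (c : {additive G -> C}) (iota : {additive C -> G})
    (tau : {additive G -> V}) (j : {additive V -> G})
    (e : G) (f : C -> bool) (chi : V -> bool)
    (E : {set bool}) (T : {set V}) :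
  (forall v : V, v + v = 0) ->
  (forall v, tau (j v) = v) -> (forall v, c (j v) = 0) ->
  tau e = 0 -> iota (c e) = e ->
  (forall v w, chi (v + w) = chi v (+) chi w) ->
  (forall x y, x + y = 0 -> x <> y -> f x != f y) ->
  (forall x y, x + y = c e + c e -> x <> y -> f x != f y) ->
  (forall x y v, v \in T -> x + y = c e -> f x (+) f y (+) chi v) ->
  exists h, two_coloring +%R (twin_set e j E T) h.
Proof.
move=> V2 tj cj te ie chiD f0 f2 f1.
have [g gN] := exists_antisymmetric G.
(* [p] kills [e] and every [j v], hence the whole twin set. *)
pose p x := x - iota (c x) - j (tau x).
have pD x y : p (x + y) = p x + p y.
  rewrite /p (raddfD c) (raddfD iota) (raddfD tau) (raddfD j).
  by rewrite !opprD [RHS]addrACA; congr (_ + _); rewrite addrACA.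
have pe : p e = 0 by rewrite /p ie subrr te raddf0 subr0.
have pj v : p (j v) = 0 by rewrite /p cj raddf0 subr0 tj subrr.
have chi0 : chi 0 = false by rewrite -(V2 0) chiD addbb.
exists (fun x => if p x + p x == 0 then f (c x) (+) chi (tau x) else g (p x)).
move=> x y xy [w wET wxy].
have VN (v : V) : - v = v by apply: (addrI v); rewrite subrr V2.
have p0 : p 0 = 0.
  by rewrite /p (raddf0 c) (raddf0 iota) (raddf0 tau) (raddf0 j) !subr0.
have pxy : p y = - p x.
  apply/eqP; rewrite -addr_eq0 addrC -pD -wxy.
  by case: (w) => [[]|v] /=; rewrite ?pD ?pe ?pj ?p0 ?addr0.
rewrite pxy -opprD oppr_eq0; case: (p x + p x =P 0) => [px2|px2]; last first.
  by rewrite gN //; case: (g (p x)).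
(* Where [2 p x = 0], doubling sees only [c x], because [V] has exponent two. So distinct [x], [y]
   with sum [0] or [2e] have distinct images under [c], as the hypotheses on [f] require. *)
have x2 : x + x = iota (c x + c x).
  have xE : x = p x + iota (c x) + j (tau x) by rewrite /p addrAC subrK subrK.
  rewrite raddfD /= {1 2}xE addrACA -(raddfD j) V2 raddf0 addr0.
  by rewrite addrACA px2 add0r.
have cneq z : x + y = z + z -> iota (c z) = z -> c x <> c y.
  move=> xyz iz cxy; apply: xy; apply: (addrI x).
  by rewrite x2 xyz {2}cxy -raddfD xyz raddfD raddfD /= iz.
have tauE b : x + y = twin_point e j (inl b) -> tau x = tau y.
  move=> xyb; apply/eqP; rewrite -subr_eq0 -(VN (tau y)) opprK -raddfD xyb.
  by case: b {xyb} => /=; rewrite ?raddfD /= ?te ?raddf0 ?addr0.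
move: w wET wxy => [b|v]; rewrite mem_dsum => wET wxy.
  have cxy := f_equal c wxy; rewrite raddfD /= in cxy.
  rewrite (tauE b (esym wxy)).
  suff : f (c x) != f (c y) by case: (f _); case: (f _); case: (chi _).
  case: b wxy cxy {wET} => /= wxy cxy.
    by apply: f2; [rewrite -cxy raddfD | apply: (cneq e)].
  by apply: f0; [rewrite -cxy raddf0 | apply: (cneq 0); rewrite ?addr0 ?raddf0].
have /= cxy := f_equal c wxy; have /= txy := f_equal tau wxy.
rewrite !raddfD /= ?cj ?tj ?te ?addr0 ?add0r in cxy txy.
have := f1 _ _ _ wET (esym cxy); rewrite txy chiD.
by case: (f _); case: (f _); case: (chi _); case: (chi _).
Qed.

(** * Odd cycles and the upper bounds they give *)

Lemma even_eltD (G : zmodType) (a b : G) :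
  even_elt a -> even_elt b -> even_elt (a + b).
Proof. by move=> [x <-] [y <-]; exists (x + y); rewrite mulrnDl. Qed.

Lemma even_elt_double (G : zmodType) (a : G) : even_elt (a + a).
Proof. by exists a; rewrite mulr2n. Qed.

(* The vertices s - a, s - b, s - c, where a + b + c = 2s, form a triangle. *)
Lemma avoidable_sum3_odd (G : zmodType) (U : set G) (a b c : G) :
  avoidable +%R U -> U a -> U b -> U c -> a <> b -> b <> c -> a <> c ->
  ~ even_elt (a + b + c).
Proof.
move=> /avoidable_two_coloring[f fU] Ua Ub Uc ab bc ac [s sE].
have tri (x y z : G) : x + y + z = s *+ 2 -> x <> y -> U z ->
    f (s - x) != f (s - y).
  move=> xyz xy Uz; apply: fU => [/addrI/oppr_inj//|].
  by rewrite addrACA -opprD -mulr2n -xyz addrC addrA addNr add0r.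
have := tri _ _ _ (esym sE) ab Uc.
have := tri b c a _ bc Ua; rewrite addrC addrA sE => /(_ erefl).
have := tri a c b _ ac Ub; rewrite addrAC sE => /(_ erefl).
by case: (f _); case: (f _); case: (f _).
Qed.

(* The five-cycle d, u - d, d - (u - v), d + (u - v), v - d has the edge labels
   u, v, 2d, u, v. *)
Lemma avoidable_odd_sub (G : zmodType) (U : set G) (b u v : G) :
  avoidable +%R U -> U b -> U u -> U v ->
  even_elt b -> ~ even_elt u -> ~ even_elt v -> (u - v) + (u - v) = 0.
Proof.
move=> /avoidable_two_coloring[f fU] Ub Uu Uv [d db] ou ov.
apply: contrapT => w2; set w := u - v in w2 *.
have uE : u = w + v by rewrite subrK.
have e1 : f d != f (u - d).
  apply: fU => [dE|]; last by rewrite addrC subrK.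
  by case: ou; exists d; rewrite mulr2n {1}dE subrK.
have e2 : f (d - w) != f (d + w).
  apply: fU => [/addrI wE|]; last by rewrite addrACA addNr addr0 -mulr2n db.
  by case: w2; rewrite -{1}wE addNr.
have e3 : f (v - d) != f d.
  apply: fU => [dE|]; last by rewrite subrK.
  by case: ov; exists d; rewrite mulr2n -{1}dE subrK.
have e4 : f (u - d) != f (d - w).
  apply: fU => [dE|]; last by rewrite addrA subrK /w opprB addrC subrK.
  case: ov; exists (d - w); rewrite mulr2n -{1}dE addrA subrK.
  by rewrite /w opprB addrC subrK.
have e5 : f (d + w) != f (v - d).
  apply: fU => [dE|]; last by rewrite addrC addrA subrK addrC -uE.
  case: ou; exists (d + w); rewrite mulr2n {1}dE addrA subrK.
  by rewrite addrC -uE.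
move: e1 e2 e3 e4 e5.
by case: (f d); case: (f (u - d)); case: (f (d - w)); case: (f (d + w));
  case: (f (v - d)).
Qed.

Definition odd_image (V : finZmodType) (G : zmodType) (tau : G -> V) (U : set G)
    : {set V} :=
  [set v | `[< exists u, [/\ U u, ~ even_elt u & tau u = v] >]]%SET.

Lemma odd_imageP (V : finZmodType) (G : zmodType) (tau : G -> V) (U : set G) v :
  reflect (exists u, [/\ U u, ~ even_elt u & tau u = v]) (v \in odd_image tau U).
Proof. by rewrite /odd_image inE; exact: asboolP. Qed.

(** [U] injects into a disjoint sum: an even [u] is sent to the truth value of [u = b], an odd one
    to [tau u]. Any collision would give, together with [b], three distinct elements of even sum. *)
Lemma card_le_odd_image (G : zmodType) (V : finZmodType)
    (tau : {additive G -> V}) (U : set G) (b : G) (E : {set bool}) :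
  (forall w, w + w = 0 -> tau w = 0 -> even_elt w) ->
  avoidable +%R U -> U b -> even_elt b ->
  (forall u, U u -> even_elt u -> (u == b) \in E) ->
  (U #<= `I_(#|E| + #|odd_image tau U|))%card.
Proof.
move=> tau_even aU Ub eb EU; rewrite -card_dsum.
pose phi u : bool + V := if pselect (even_elt u) then inl (u == b) else inr (tau u).
apply: (card_le_finset (g := phi)) => [u Uu|u v Uu Uv].
  rewrite mem_dsum /phi; case: pselect => eu; first exact: EU.
  by apply/odd_imageP; exists u.
rewrite /phi; case: pselect => eu; case: pselect => ev // -[].
  have [->|/eqP ub] := eqVneq u b; first by move/esym/eqP.
  move=> /esym/negbT/eqP vb; apply: contrapT => uv.
  by apply: (avoidable_sum3_odd aU Uu Uv Ub uv vb ub); do !apply: even_eltD.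
move=> tuv; apply: contrapT => uv.
(* The five-cycle makes [u - v] an involution; it is killed by [tau], hence even, so [u + v + b] is
   even too. *)
have w2 := avoidable_odd_sub aU Ub Uu Uv eb eu ev.
have ew : even_elt (u - v) by apply: tau_even; rewrite // raddfB tuv subrr.
apply: (avoidable_sum3_odd aU Uu Uv Ub uv); [by move=> vb; apply: ev; rewrite vb|
  by move=> ub; apply: eu; rewrite ub|].
apply: even_eltD => //; rewrite -(subrK v u) -addrA.
exact: even_eltD (even_elt_double v).
Qed.

(** For [v0] in [D], the translate [D + v0] is disjoint from [D]: a common value would yield odd
    [u0], [u1], [u2] in [U] whose sum is killed by [tau], hence even. They are distinct, since if
    two agreed the third would have [tau] equal to 0. *)
Lemma double_card_odd_image (G : zmodType) (V : finZmodType)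
    (tau : {additive G -> V}) (U : set G) (b : G) :
  (forall v : V, v + v = 0) -> (forall w, tau w = 0 -> even_elt w) ->
  avoidable +%R U -> U b -> even_elt b ->
  (#|odd_image tau U| * 2 <= #|V|)%N.
Proof.
move=> V2 tau_even aU Ub eb; set D := odd_image tau U.
have [->|[v0 v0D]] := set_0Vmem D; first by rewrite cards0.
have /odd_imageP[u0 [Uu0 ou0 tu0]] := v0D.
have D0 u : ~ even_elt u -> tau u <> 0 by move=> ou /tau_even.
rewrite muln2 -addnn -{2}(card_imset D (addIr v0)) -cardsUI.
rewrite (_ : _ :&: _ = finset.set0) ?cards0 ?addn0 ?max_card //.
apply/setP => v; rewrite finset.inE finset.in_set0.
apply/negbTE/negP => /andP[/odd_imageP[u2 [Uu2 ou2 tu2]]].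
case/imsetP => v1 /odd_imageP[u1 [Uu1 ou1 tu1]] vE.
have tsum : tau u0 + tau u1 + tau u2 = 0.
  by rewrite tu0 tu1 tu2 vE (addrC v0) V2.
apply: (avoidable_sum3_odd aU Uu0 Uu1 Uu2).
- by move=> u01; apply: (D0 _ ou2); rewrite -tsum u01 V2 add0r.
- by move=> u12; apply: (D0 _ ou0); rewrite -tsum u12 -addrA V2 addr0.
- by move=> u02; apply: (D0 _ ou1); rewrite -tsum u02 addrAC V2 add0r.
- by apply: tau_even; rewrite !raddfD.
Qed.

(* The library has no join of its two structures on {ffun I -> W}. *)
HB.instance Definition _ (I : finType) (W : finZmodType) :=
  GRing.Zmodule.on {ffun I -> W}.

(** * Transport along isomorphisms, and sizes of the extremal sets *)

Lemma is_max_size_bij (G H : zmodType) (h : {additive G -> H}) (m : nat) :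
  bijective h -> is_max_size (avoidable_with_even H) m ->
  is_max_size (avoidable_with_even G) m.
Proof.
have transfer (G1 G2 : zmodType) (f : {additive G1 -> G2}) (g : G2 -> G1)
    (U : set G2) : cancel f g -> cancel g f -> avoidable_with_even G2 U ->
    avoidable_with_even G1 (f @^-1` U)%classic.
  move=> fK gK [[A [B [[A0 B0 AB1 AB0] hU]]] [b Ub [x xb]]]; split; last first.
    exists (g b); first by rewrite /= gK.
    by exists (g x); apply: (can_inj fK); rewrite raddfMn /= !gK.
  exists (f @^-1` A)%classic, (f @^-1` B)%classic; split.
    split.
    - by case: A0 => a Aa; exists (g a); rewrite /= gK.
    - by case: B0 => a Ba; exists (g a); rewrite /= gK.
    - by rewrite -preimage_setU AB1 preimage_setT.
    - by rewrite -preimage_setI AB0 preimage_set0.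
  move=> u /= Uu; have [nA nB] := hU _ Uu.
  by split=> -[y [z [/= ay az yz yzu]]]; [apply: nA | apply: nB];
    exists (f y), (f z); split => //; rewrite -?raddfD ?yzu // => /(can_inj fK).
have card_preim (T1 T2 : Type) (f : T1 -> T2) (g : T2 -> T1) (U : set T2) :
    cancel f g -> cancel g f -> ((f @^-1` U)%classic #= U)%card.
  move=> fK gK; rewrite (_ : (f @^-1` U)%classic = (g @` U)%classic).
    by apply: inj_card_eq => x y _ _; apply: can_inj.
  apply/seteqP; split=> [x Ufx|_ [y Uy <-]]; last by rewrite /= gK.
  by exists (f x) => //; rewrite fK.
move=> [k hK kK] [[U aU cU] bU].
(* The inverse is made additive so that sets can be transferred in the other direction for the upper
   bound. *)
pose kA := Algebra.isZmodMorphism.Build H G k (can2_zmod_morphism hK kK).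
pose k' : {additive H -> G} := HB.pack k kA.
split=> [|W aW].
  exists (h @^-1` U)%classic; first exact: transfer aU.
  by rewrite (card_eql (card_preim _ _ _ _ _ hK kK)).
rewrite -(card_le_eql (card_preim _ _ _ _ _ kK hK)).
by apply: bU; exact: (transfer _ _ k').
Qed.

Lemma twin_set_max_size (G C : zmodType) (V : finZmodType)
    (c : {additive G -> C}) (iota : {additive C -> G})
    (tau : {additive G -> V}) (j : {additive V -> G})
    (e : G) (f : C -> bool) (chi : V -> bool) (T : {set V}) :
  (forall v : V, v + v = 0) ->
  (forall v, tau (j v) = v) -> (forall v, c (j v) = 0) ->
  tau e = 0 -> iota (c e) = e -> c e + c e <> 0 ->
  (forall v w, chi (v + w) = chi v (+) chi w) ->
  (forall x y, x + y = 0 -> x <> y -> f x != f y) ->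
  (forall x y, x + y = c e + c e -> x <> y -> f x != f y) ->
  (forall x y v, v \in T -> x + y = c e -> f x (+) f y (+) chi v) ->
  exists2 U, avoidable_with_even G U & (U #= `I_(2 + #|T|))%card.
Proof.
move=> V2 tj cj te ie ce2 chiD f0 f2 f1.
have [h hU] := twin_set_coloring [set: bool] V2 tj cj te ie chiD f0 f2 f1.
have ce0 : c e <> 0 by move=> ce0; apply: ce2; rewrite ce0 addr0.
have ee0 : e + e <> 0 by move=> ee0; apply: ce2; rewrite -raddfD ee0 raddf0.
exists (twin_set e j [set: bool] T).
  split.
    apply: two_coloring_avoidable hU; exists (e + e), 0; split=> //.
    by rewrite addr0; exists (inl true); rewrite ?mem_dsum ?inE.
  by exists 0; [exists (inl false); rewrite ?mem_dsum ?inE|exists 0; rewrite mul0rn].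
(* [c] takes the pairwise distinct values [0], [2 c e] and [c e] on the three kinds of points, and
   [tau] tells the points [e + j v] apart. *)
have -> : (2 + #|T|)%N = #|dsum [set: bool] T| by rewrite card_dsum cardsT card_bool.
apply: card_eq_finset => x y _ _ xy; have := f_equal c xy.
move: x y xy => [[]|v] [[]|w] //= xy; rewrite ?raddfD ?raddf0 /= ?cj ?addr0 //.
- by move/(canRL (addrK _)); rewrite subrr => /ce0.
- by move/esym.
- by move/esym.
- by move/esym/(canRL (addrK _)); rewrite subrr => /ce0.
- by move: xy => /addrI jvw _; rewrite -(tj v) jvw tj.
Qed.

(** The twin set with [e = 0] and trivial [C = 'I_1]. Since [0] and [2e] coincide, only the label
    [false] is kept; the constant [f] leaves [chi] to separate the ends of the edges with sum
    [j v]. *)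
Lemma degenerate_max_size (G : zmodType) (V : finZmodType)
    (tau : {additive G -> V}) (j : {additive V -> G}) (chi : V -> bool) :
  (forall v : V, v + v = 0) -> (forall v, tau (j v) = v) ->
  (forall v w, chi (v + w) = chi v (+) chi w) -> (exists v, chi v) ->
  exists2 U, avoidable_with_even G U &
    (U #= `I_(1 + #|[set v | chi v]|))%card.
Proof.
move=> V2 tj chiD [v0 chi0]; set T := finset.finset _.
have [|||h hU] := @twin_set_coloring G 'I_1 V \0 \0 tau j 0 xpred0 chi
   [set false] T V2 tj (fun=> erefl) (raddf0 tau) erefl chiD.
- by move=> x y; rewrite (ord1 x) (ord1 y).
- by move=> x y; rewrite (ord1 x) (ord1 y).
- by move=> x y v; rewrite inE.
have T0 v : v \in T -> j v <> 0.
  rewrite inE => chiv jv; move: chiv.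
  by rewrite -(tj v) jv raddf0 -(V2 0) chiD addbb.
exists (twin_set 0 j [set false] T).
  split.
    have v0T : v0 \in T by rewrite inE.
    apply: two_coloring_avoidable hU; exists (j v0), 0; split; first exact: T0.
    by exists (inr v0); rewrite ?mem_dsum //= add0r addr0.
  by exists 0; [exists (inl false); rewrite ?mem_dsum ?inE|exists 0; rewrite mul0rn].
have -> : (1 + #|T|)%N = #|dsum [set false] T| by rewrite card_dsum cards1.
apply: card_eq_finset => x y; rewrite !mem_dsum.
move: x y => [a|v] [b|w] //=; rewrite ?add0r.
- by move=> /set1P -> /set1P ->.
- by move=> /set1P -> /T0 w0 /esym.
- by move=> /T0 v0' /set1P ->.
- by move=> _ _ jvw; rewrite -(tj v) -(tj w) jvw.
Qed.

(** Translation by an element where [chi] is true exchanges the kernel and its complement. *)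
Lemma card_character (V : finZmodType) (chi : V -> bool) :
  (forall v w, chi (v + w) = chi v (+) chi w) -> (exists v, chi v) ->
  (#|[set v | chi v]%SET| * 2 = #|V|)%N.
Proof.
move=> chiD [v0 chi0]; set T := finset.finset _.
rewrite -cardsT -(finset.setUCr T) cardsU.
rewrite finset.setICr cards0 subn0 muln2 -addnn; congr addn.
rewrite -(card_imset _ (addIr v0)); apply: eq_card => v.
apply/imsetP/idP => [[w]|]; rewrite !inE.
  by move=> cw ->; rewrite chiD cw chi0.
move=> cv; exists (v - v0); rewrite ?subrK // inE.
by move: (chiD (v - v0) v0) cv; rewrite subrK chi0 => ->; case: (chi _).
Qed.

(** * Arithmetic and colourings of the cyclic summands *)

(** Two representatives wrap around at most once; this turns equations modulo [N] into linear
    arithmetic for [lia]. *)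
Lemma Zp_addE (N : nat) (x y z : 'Z_N) : (1 < N)%N -> x + y = z ->
  (x + y = z)%N \/ (x + y = z + N)%N.
Proof.
move=> N1 <-.
have -> : (x + y)%R = ((x + y) %% N)%N :> nat.
  by rewrite -[X in (_ %% X)%N](Zp_cast N1).
have xN : (x < N)%N by rewrite -[X in (_ < X)%N](Zp_cast N1).
have yN : (y < N)%N by rewrite -[X in (_ < X)%N](Zp_cast N1).
have [xyN|Nxy] := ltnP (x + y) N; first by left; rewrite modn_small.
right; rewrite -{2}(subnK Nxy) modnDr modn_small ?subnK //; lia.
Qed.

Lemma Zp_lt (N : nat) (x : 'Z_N) : (1 < N)%N -> (x < N)%N.
Proof. by move=> N1; rewrite -[X in (_ < X)%N](Zp_cast N1). Qed.

Lemma Zp_neq (N : nat) (x y : 'Z_N) : x <> y -> (x <> y :> nat).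
Proof. by move=> xy /val_inj. Qed.

Lemma Zp_odd_halve (n : nat) (x : 'Z_(2 * n + 1)) :
  (0 < n)%N -> x *+ n.+1 *+ 2 = x.
Proof.
move=> n0; rewrite -mulrnA (_ : n.+1 * 2 = 2 * n + 1 + 1)%N; last lia.
by rewrite mulrnDr -mulr_natr pchar_Zp ?mulr0 ?add0r //; lia.
Qed.

Lemma Zp4_halve (q : nat) (x : 'Z_(4 * q)) :
  (0 < q)%N -> x + x = 0 -> (x./2)%:R *+ 2 = x.
Proof.
move=> q0 x2; have q1 : (1 < 4 * q)%N by lia.
have ev : (x./2 * 2 = x)%N.
  by case: (Zp_addE q1 x2) => /=; lia.
by rewrite -mulrnA ev natr_Zp.
Qed.

Lemma Z2_double (x : 'Z_2) : x + x = 0.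
Proof. by rewrite -mulr2n -mulr_natr pchar_Zp ?mulr0. Qed.

(** The cut between 0 and 1 separates any two distinct integers exchanged by the reflection about 0,
    about 1 or about 1/2; the last has no fixed point. *)
Lemma int_coloring0 (x y : int) : x + y = 0 -> x <> y -> (x <= 0) != (y <= 0).
Proof. lia. Qed.

Lemma int_coloring2 (x y : int) : x + y = 1 + 1 -> x <> y -> (x <= 0) != (y <= 0).
Proof. lia. Qed.

Lemma int_coloring1 (x y : int) : x + y = 1 -> (x <= 0) (+) (y <= 0).
Proof. lia. Qed.

Lemma Zp4_one (q : nat) : (0 < q)%N ->
  nat_of_ord (1 : 'Z_(4 * q)) = 1%N /\ nat_of_ord (1 + 1 : 'Z_(4 * q)) = 2%N.
Proof.
move=> q0; have q1 : (1 < 4 * q)%N by lia.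
split; first by rewrite (val_Zp_nat q1 1%N) modn_small.
by rewrite (val_Zp_nat q1 2%N) modn_small //; lia.
Qed.

(** The arc from 1 to [2q] and its complement are exchanged by [x -> 1 - x]. The fixed points of
    [x -> -x] (0 and [2q]) and of [x -> 2 - x] (1 and [2q + 1]) are end points of the arcs, and all
    other points change arc. *)
Lemma Zp4_coloring (q : nat) (f := fun x : 'Z_(4 * q) => (1 <= x <= 2 * q)%N) :
  (0 < q)%N ->
  [/\ forall x y, x + y = 0 -> x <> y -> f x != f y,
      forall x y, x + y = 1 + 1 -> x <> y -> f x != f y &
      forall x y, x + y = 1 -> f x (+) f y].
Proof.
move=> q0; have q1 : (1 < 4 * q)%N by lia.
have [v1 v2] := Zp4_one q0.
rewrite /f; split=> x y xyz; have := Zp_addE q1 xyz; have := Zp_lt x q1;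
  have := Zp_lt y q1; rewrite ?v1 ?v2 /=; try (move=> ? ? ? /Zp_neq); lia.
Qed.

(* Here 2z = 1, and the colouring alternates along the path 0, 1, -1, 2, -2, ...
   traced by x -> 1 - x and x -> -x; x -> z - x reverses this path of odd length,
   so it preserves the colour. *)
Lemma Zp_odd_coloring (n : nat) (f := fun x : 'Z_(2 * n + 1) => (1 <= x <= n)%N)
    (z : 'Z_(2 * n + 1) := n.+1%:R) : (0 < n)%N ->
  [/\ forall x y, x + y = 0 -> x <> y -> f x != f y,
      forall x y, x + y = z + z -> x <> y -> f x != f y &
      forall x y, x + y = z -> f x = f y].
Proof.
move=> n0; have n1 : (1 < 2 * n + 1)%N by lia.
have vz : z = n.+1 :> nat by rewrite /z val_Zp_nat // modn_small //; lia.
have zz : z + z = 1 by rewrite -mulr2n /z Zp_odd_halve.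
have v1 : (1 : 'Z_(2 * n + 1)) = 1%N :> nat.
  by rewrite (@val_Zp_nat _ n1 1%N) modn_small.
rewrite zz /f; split=> x y xyz; have := Zp_addE n1 xyz; have := Zp_lt x n1;
  have := Zp_lt y n1; rewrite ?v1 ?vz /=; try (move=> ? ? ? /Zp_neq); lia.
Qed.

(** * Coordinate maps of the direct sum *)

(** These injections and projections are named so that they can carry an additive structure, which
    their composites inherit. *)
Definition pair_inl (A B : zmodType) (a : A) : (A * B)%type := (a, 0).
Definition pair_inr (A B : zmodType) (b : B) : (A * B)%type := (0, b).
Definition dffun_coord (I : finType) (W : I -> zmodType) (i : I)
  (x : {dffun forall k, W k}) : W i := x i.
Definition dffun_single (I : finType) (W : I -> zmodType) (i : I) (a : W i) :
  {dffun forall k, W k} := [ffun k => dfwith (fun k => 0 : W k) a k].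
Definition ffun_coord (I : finType) (W : zmodType) (i : I)
  (x : {ffun I -> W}) : W := x i.
Definition ffun_single (I : finType) (W : zmodType) (i : I) (a : W) :
  {ffun I -> W} := [ffun k => if k == i then a else 0].

Fact pair_inl_is_zmod_morphism A B : Algebra.zmod_morphism (@pair_inl A B).
Proof. by move=> x y; congr pair; rewrite /= subr0. Qed.
Fact pair_inr_is_zmod_morphism A B : Algebra.zmod_morphism (@pair_inr A B).
Proof. by move=> x y; congr pair; rewrite /= subr0. Qed.
Fact dffun_coord_is_zmod_morphism I W i : Algebra.zmod_morphism (@dffun_coord I W i).
Proof. by move=> x y; rewrite /dffun_coord !ffunE. Qed.
Fact ffun_coord_is_zmod_morphism I W i : Algebra.zmod_morphism (@ffun_coord I W i).
Proof. by move=> x y; rewrite /ffun_coord !ffunE. Qed.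
Fact dffun_single_is_zmod_morphism I W i :
  Algebra.zmod_morphism (@dffun_single I W i).
Proof.
move=> a b; apply/ffunP => k; rewrite !ffunE.
have [ik|ik] := eqVneq i k; first by case: _ / ik; rewrite !dfwith_in.
by rewrite !dfwith_out // subr0.
Qed.
Fact ffun_single_is_zmod_morphism I W i : Algebra.zmod_morphism (@ffun_single I W i).
Proof.
by move=> a b; apply/ffunP => k; rewrite !ffunE; case: ifP; rewrite ?subr0.
Qed.

HB.instance Definition _ A B :=
  Algebra.isZmodMorphism.Build _ _ (@pair_inl A B) (@pair_inl_is_zmod_morphism A B).
HB.instance Definition _ A B :=
  Algebra.isZmodMorphism.Build _ _ (@pair_inr A B) (@pair_inr_is_zmod_morphism A B).
HB.instance Definition _ I W i :=
  Algebra.isZmodMorphism.Build _ _ (@dffun_coord I W i)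
    (@dffun_coord_is_zmod_morphism I W i).
HB.instance Definition _ I W i :=
  Algebra.isZmodMorphism.Build _ _ (@ffun_coord I W i)
    (@ffun_coord_is_zmod_morphism I W i).
HB.instance Definition _ I W i :=
  Algebra.isZmodMorphism.Build _ _ (@dffun_single I W i)
    (@dffun_single_is_zmod_morphism I W i).
HB.instance Definition _ I W i :=
  Algebra.isZmodMorphism.Build _ _ (@ffun_single I W i)
    (@ffun_single_is_zmod_morphism I W i).

Lemma dffun_coord_single (I : finType) (W : I -> zmodType) (i : I) (a : W i) :
  dffun_coord i (dffun_single a) = a.
Proof. by rewrite /dffun_coord ffunE dfwith_in. Qed.

Lemma card_ffunZ2 (m : nat) : #|{ffun 'I_m -> 'Z_2}| = (2 ^ m)%N.
Proof. by rewrite card_ffun !card_ord. Qed.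

Lemma ffunZ2_double (m : nat) (v : {ffun 'I_m -> 'Z_2}) : v + v = 0.
Proof. by apply/ffunP => i; rewrite !ffunE Z2_double. Qed.

(** Makes each coordinate of [(Z/2)^m2] a boolean character. *)
Lemma Z2_neq0D (x y : 'Z_2) : (x + y != 0) = (x != 0) (+) (y != 0).
Proof. by case: x y => -[|[|[]]] // ? [[|[|[]]] // ?]. Qed.

Definition fgab_tau (m1 m2 m3 r : nat) (n : 'I_m1 -> nat) (q : 'I_m3 -> nat) :
    {additive fgab m2 r n q -> {ffun 'I_m2 -> 'Z_2}} :=
  (snd \o (fst \o fst))%FUN.

Definition fgab_j (m1 m2 m3 r : nat) (n : 'I_m1 -> nat) (q : 'I_m3 -> nat) :
    {additive {ffun 'I_m2 -> 'Z_2} -> fgab m2 r n q} :=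
  (@pair_inl _ _ \o (@pair_inl _ _ \o @pair_inr _ _))%FUN.

(** * Lower bounds from a single cyclic summand *)

(** The reflection [x -> 1 - x] already flips the colour, so the trivial character works and [T] can
    be all of [V]. *)
Lemma fgab_lower_int (m1 m2 m3 r : nat) (n : 'I_m1 -> nat) (q : 'I_m3 -> nat)
    (i : 'I_r) :
  exists2 U, avoidable_with_even (fgab m2 r n q) U & (U #= `I_(2 + 2 ^ m2))%card.
Proof.
pose c : {additive fgab m2 r n q -> int} := (@ffun_coord _ _ i \o snd)%FUN.
pose iota : {additive int -> fgab m2 r n q} :=
  (@pair_inr _ _ \o @ffun_single _ _ i)%FUN.
have ci a : c (iota a) = a by rewrite /c /= /ffun_coord ffunE eqxx.
have := @twin_set_max_size _ _ _ c iota (fgab_tau m2 r n q) (fgab_j m2 r n q)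
  (iota 1) (fun x => x <= 0) xpred0 [set: _].
rewrite cardsT card_ffunZ2 ci; apply=> //.
- exact: ffunZ2_double.
- by move=> v; rewrite /c /= /ffun_coord ffunE.
- exact: int_coloring0.
- exact: int_coloring2.
- by move=> x y v _ xy; rewrite addbF; apply: int_coloring1.
Qed.

Lemma fgab_lower_Z4 (m1 m2 m3 r : nat) (n : 'I_m1 -> nat) (q : 'I_m3 -> nat)
    (i : 'I_m3) : (0 < q i)%N ->
  exists2 U, avoidable_with_even (fgab m2 r n q) U & (U #= `I_(2 + 2 ^ m2))%card.
Proof.
move=> qi; have [f0 f2 f1] := Zp4_coloring qi.
pose W k : zmodType := 'Z_(4 * q k).
pose c : {additive fgab m2 r n q -> W i} := (@dffun_coord _ W i \o (snd \o fst))%FUN.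
pose iota : {additive W i -> fgab m2 r n q} :=
  (@pair_inl _ _ \o (@pair_inr _ _ \o @dffun_single _ W i))%FUN.
have ci a : c (iota a) = a by exact: dffun_coord_single.
have := @twin_set_max_size _ _ _ c iota (fgab_tau m2 r n q) (fgab_j m2 r n q)
  (iota 1%R) _ xpred0 [set: _] _ _ _ _ _ _ _ f0.
rewrite cardsT card_ffunZ2 ci; apply=> //.
- exact: ffunZ2_double.
- by move=> v; rewrite /c /= /dffun_coord ffunE.
- by move=> /(f_equal (@nat_of_ord _)); have [_ ->] := Zp4_one qi.
- by move=> x y v _ xy; rewrite addbF; apply: f1.
Qed.

(** In an odd summand [x -> e - x] preserves the colour, so the flip has to come from [chi], which
    restricts [T] to the elements where [chi] is true. *)
Lemma fgab_lower_odd (m1 m2 m3 r : nat) (n : 'I_m1 -> nat) (q : 'I_m3 -> nat)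
    (i : 'I_m1) (chi : {ffun 'I_m2 -> 'Z_2} -> bool) : (0 < n i)%N ->
  (forall v w, chi (v + w) = chi v (+) chi w) ->
  exists2 U, avoidable_with_even (fgab m2 r n q) U &
    (U #= `I_(2 + #|[set v | chi v]%SET|))%card.
Proof.
move=> ni chiD; have [f0 f2 f1] := Zp_odd_coloring ni.
pose W k : zmodType := 'Z_(2 * n k + 1).
pose c : {additive fgab m2 r n q -> W i} :=
  (@dffun_coord _ W i \o (fst \o (fst \o fst)))%FUN.
pose iota : {additive W i -> fgab m2 r n q} :=
  (@pair_inl _ _ \o (@pair_inl _ _ \o (@pair_inl _ _ \o @dffun_single _ W i)))%FUN.
have ci a : c (iota a) = a by exact: dffun_coord_single.
apply: (@twin_set_max_size _ _ _ c iota (fgab_tau m2 r n q) (fgab_j m2 r n q)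
  (iota ((n i).+1%:R : 'Z_(2 * n i + 1))) _ chi _ _ _ _ _ _ _ _ f0);
  rewrite ?ci //.
- exact: ffunZ2_double.
- by move=> v; rewrite /c /= /dffun_coord ffunE.
- by rewrite -mulr2n Zp_odd_halve //; apply/eqP/oner_neq0.
- by move=> x y v; rewrite inE => chiv /f1 ->; rewrite addbb.
Qed.

(** * Upper bounds in the direct sum *)

Lemma int_double0 (x : int) : x + x = 0 -> 0 = x.
Proof. lia. Qed.

(** Serves both upper bounds: it covers every involution killed by [tau], and, when [m3 = r = 0],
    every element killed by [tau]. *)
Lemma fgab_halve (m1 m2 m3 r : nat) (n : 'I_m1 -> nat) (q : 'I_m3 -> nat)
    (w : fgab m2 r n q) :
  (forall i, (0 < n i)%N) -> (forall i, (0 < q i)%N) ->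
  w.1.1.2 = 0 -> w.1.2 + w.1.2 = 0 -> w.2 + w.2 = 0 -> even_elt w.
Proof.
case: w => [[[x y] z] t] hn hq /= y0 z2 t2.
(* Coordinatewise halves: [n i + 1] inverts 2 modulo [2 * n i + 1]; 2-torsion modulo [4 * q i] is 0
   or [2 * q i], with even representative; 2-torsion in [int] is 0. *)
exists ([ffun i => x i *+ (n i).+1], 0, [ffun i => ((z i)./2)%:R], 0).
rewrite mulr2n; congr (_, _, _, _).
- by apply/ffunP => i; rewrite !ffunE -mulr2n Zp_odd_halve.
- by rewrite y0 /= addr0.
- apply/ffunP => i; rewrite !ffunE -mulr2n Zp4_halve //.
  by move/ffunP/(_ i): z2; rewrite !ffunE.
- apply/ffunP => i; rewrite !ffunE addr0.
  by move/ffunP/(_ i): t2; rewrite !ffunE; exact: int_double0.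
Qed.

Lemma fgab_upper (m1 m2 m3 r : nat) (n : 'I_m1 -> nat) (q : 'I_m3 -> nat)
    (U : set (fgab m2 r n q)) :
  (forall i, (0 < n i)%N) -> (forall i, (0 < q i)%N) ->
  avoidable_with_even _ U ->
  (U #<= `I_(2 + #|odd_image (fgab_tau m2 r n q) U|))%card.
Proof.
move=> hn hq [aU [b Ub eb]].
have cb : #|[set: bool]| = 2%N by rewrite cardsT card_bool.
rewrite -[X in (X + _)%N]cb.
apply: (card_le_odd_image _ aU Ub eb) => [w w2 w0|u _ _]; last by rewrite inE.
apply: fgab_halve => //; first exact: (f_equal (snd \o fst) w2).
exact: (f_equal snd w2).
Qed.

Lemma fgab_even_torsion (m1 m2 m3 r : nat) (n : 'I_m1 -> nat)
    (q : 'I_m3 -> nat) (w : fgab m2 r n q) :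
  (forall i, (0 < n i)%N) -> (forall i, (0 < q i)%N) -> m3 = 0%N -> r = 0%N ->
  fgab_tau m2 r n q w = 0 -> even_elt w.
Proof.
move=> hn hq m30 r0 w0; apply: fgab_halve => //.
  by apply/ffunP => -[i i0]; exfalso; rewrite m30 in i0.
by apply/ffunP => -[i i0]; exfalso; rewrite r0 in i0.
Qed.

Lemma fgab_odd_image_torsion (m1 m2 m3 r : nat) (n : 'I_m1 -> nat)
    (q : 'I_m3 -> nat) (U : set (fgab m2 r n q)) :
  (forall i, (0 < n i)%N) -> (forall i, (0 < q i)%N) ->
  m3 = 0%N -> r = 0%N -> avoidable_with_even _ U ->
  (#|odd_image (fgab_tau m2 r n q) U| * 2 <= 2 ^ m2)%N.
Proof.
move=> hn hq m30 r0 [aU [b Ub eb]].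
rewrite -card_ffunZ2; apply: (double_card_odd_image (b := b)) => //.
  exact: ffunZ2_double.
by move=> w; apply: fgab_even_torsion.
Qed.

(** * Assembly of the four cases *)

Theorem theorem2p6 (m1 m2 m3 r : nat) (n : 'I_m1 -> nat) (q : 'I_m3 -> nat)
    (hn : forall i, (0 < n i)%N) (hq : forall i, (0 < q i)%N)
    (G : zmodType) (iso : {additive G -> fgab m2 r n q})
    (hiso : bijective iso) :
  [/\ m1 = 0%N -> m2 <> 0%N -> m3 = 0%N -> r = 0%N ->
        is_max_size (avoidable_with_even G) (1 + 2 ^ (m2 - 1))%N,
      m1 <> 0%N -> m2 = 0%N -> m3 = 0%N -> r = 0%N ->
        is_max_size (avoidable_with_even G) 2%N,
      m1 <> 0%N -> m2 <> 0%N -> m3 = 0%N -> r = 0%N ->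
        is_max_size (avoidable_with_even G) (2 + 2 ^ (m2 - 1))%N &
      m3 <> 0%N \/ r <> 0%N ->
        is_max_size (avoidable_with_even G) (2 + 2 ^ m2)%N].
Proof.
have ord_of k : k <> 0%N -> 'I_k by case: k => // k _; exact: ord0.
have pow2 k : k <> 0%N -> (2 ^ k = 2 ^ (k - 1) * 2)%N.
  by case: k => // k _; rewrite subn1 expnSr.
pose chi (i : 'I_m2) (v : {ffun 'I_m2 -> 'Z_2}) := v i != 0.
have chiD i v w : chi i (v + w) = chi i v (+) chi i w.
  by rewrite /chi ffunE Z2_neq0D.
have chi1 i : exists v, chi i v by exists [ffun=> 1]; rewrite /chi ffunE.
have cardT i : #|[set v | chi i v]%SET| = (2 ^ (m2 - 1))%N.
  apply/eqP; rewrite -(eqn_pmul2r (isT : (0 < 2)%N)) -pow2; last first.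
    by move=> m20; case: i => k; rewrite m20.
  by rewrite (card_character (chiD i) (chi1 i)) card_ffunZ2.
split=> [m10 m20 m30 r0|m10 m20 m30 r0|m10 m20 m30 r0|m3r];
  apply: is_max_size_bij hiso _; split=> [|U aU].
- have i := ord_of _ m20.
  rewrite -(cardT i); apply: (degenerate_max_size (tau := fgab_tau m2 r n q)
    (j := fgab_j m2 r n q)) => //.
  exact: ffunZ2_double.
(* The group has exponent two, so 0 is its only even element and a single even label, [true],
   suffices. *)
- have dbl (w : fgab m2 r n q) : w + w = 0.
    case: w => [[[x y] z] t]; congr (_, _, _, _).
    + by apply/ffunP => -[i i0]; exfalso; rewrite m10 in i0.
    + exact: ffunZ2_double.
    + by apply/ffunP => -[i i0]; exfalso; rewrite m30 in i0.
    + by apply/ffunP => -[i i0]; exfalso; rewrite r0 in i0.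
  have card_odd := fgab_odd_image_torsion hn hq m30 r0 aU.
  have [aU' [b Ub eb]] := aU.
  have ev0 (w : fgab m2 r n q) : even_elt w -> w = 0.
    by case=> x <-; rewrite mulr2n dbl.
  apply: card_le_trans (card_le_odd_image (tau := fgab_tau m2 r n q)
    (E := [set true]) _ aU' Ub eb _) _.
  + by move=> w _; apply: fgab_even_torsion.
  + by move=> u _ /ev0 ->; rewrite (ev0 b eb) eqxx inE.
  + by rewrite card_le_II cards1 leq_add2l; rewrite pow2 // leq_pmul2r in card_odd.
(* The zero character makes [T] empty, which leaves [{0, 2e}]. *)
- have i := ord_of _ m10.
  have [U aU cU] := @fgab_lower_odd m1 m2 m3 r n q i xpred0 (hn i)
    (fun _ _ => erefl).
  exists U => //; move: cU; rewrite [X in (2 + X)%N]eq_card0 // => v.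
  by rewrite !inE.
- apply: card_le_trans (fgab_upper hn hq aU) _.
  (* As [2 ^ m2 = 1], twice the number of odd values is at most 1, so there are none. *)
  have := fgab_odd_image_torsion hn hq m30 r0 aU.
  by rewrite card_le_II [X in (2 ^ X)%N]m20; lia.
(* A coordinate of [V] as the character gives a [T] filling half of [V]. *)
- have i := ord_of _ m10; have k := ord_of _ m20.
  by rewrite -(cardT k); exact: fgab_lower_odd (hn i) (chiD k).
- apply: card_le_trans (fgab_upper hn hq aU) _.
  have := fgab_odd_image_torsion hn hq m30 r0 aU.
  by rewrite card_le_II pow2 // leq_pmul2r // leq_add2l.
- by case: m3r => [/ord_of i|/ord_of i]; [exact: fgab_lower_Z4 (hq i)|
    exact: fgab_lower_int].
- apply: card_le_trans (fgab_upper hn hq aU) _.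
  by rewrite card_le_II leq_add2l -card_ffunZ2 max_card.
Qed.
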